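(* Let $m \ge 4$ be even and let $a,b$ be integers with $1 \le a \le b < \frac{m}{2}$. Then the graph $B_1(m;a,b)$ is a nut graph if and only if all of the following hold: (i) $m \equiv 2 \pmod 4$; (ii) $a$ and $b$ are both even; (iii) $\gcd(\frac m2, a, b)=1$; (iv) if $5 \mid m$, then at least one of $a, b, a-b, a+b$ is divisible by $5$.
   Context: A graph is a nut graph if $0$ is an adjacency eigenvalue of multiplicity one and a corresponding eigenvector has no zero entries. $B_1(m;a,b)$ is the graph on vertices $x_0,\dots,x_{m-1},y_0,\dots,y_{m-1}$ (indices mod $m$) with edges $x_ix_{i\pm a}$, $x_ix_{i+m/2}$, $y_iy_{i\pm b}$, $y_iy_{i+m/2}$ and $x_iy_i$ for all $i$. *)

(* Defs.v *)
From mathcomp Require Import all_boot all_order all_algebra.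
From mathcomp Require Import reals.
From mathcomp Require Import ring.

Set Implicit Arguments.
Unset Strict Implicit.
Unset Printing Implicit Defensive.

Import Order.TTheory GRing.Theory Num.Theory.
Local Open Scope ring_scope.

(* A simple graph on the vertex set T is a symmetric irreflexive e : rel T. *)

Definition adjmx (R : realType) (T : finType) (e : rel T) : 'M[R]_#|T| :=
  \matrix_(i, j) (e (enum_val i) (enum_val j))%:R.

Definition is_eigenvector (R : realType) (n : nat) (A : 'M[R]_n) (z : R)
    (v : 'cV[R]_n) : Prop :=
  v != 0 /\ A *m v = z *: v.

(* The multiplicity of an eigenvalue is its multiplicity as a root of the
   characteristic polynomial; for the symmetric matrix [adjmx R e] this is also
   the dimension of the eigenspace. *)
Definition nut_graph (R : realType) (T : finType) (e : rel T) : Prop :=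
  mup 0 (char_poly (adjmx R e)) = 1%N /\
  exists v : 'cV[R]_#|T|,
    is_eigenvector (adjmx R e) 0 v /\ (forall i, v i 0 != 0).

(* [circ_adj m s i j] holds when j is i + s, i - s or i + m/2 modulo m. *)
Definition circ_adj (m : nat) (s : int) : rel 'I_m := fun i j =>
  [|| (j%:Z == i%:Z + s %[mod m%:Z])%Z,
      (j%:Z == i%:Z - s %[mod m%:Z])%Z
    | (j%:Z == i%:Z + (m %/ 2)%:Z %[mod m%:Z])%Z].

(* The vertex x_i is [inl i] and y_i is [inr i]. *)
Definition B1 (m : nat) (a b : int) : rel ('I_m + 'I_m)%type := fun u v =>
  match u, v with
  | inl i, inl j => circ_adj a i j
  | inr i, inr j => circ_adj b i j
  | inl i, inr j | inr i, inl j => i == j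
  end.

Lemma circ_adj_sym (m : nat) (s : int) : ~~ odd m -> symmetric (@circ_adj m s).
Proof.
move=> m_even i j; rewrite /circ_adj !eqz_mod_dvd.
have Em : m%:Z = (m %/ 2)%:Z + (m %/ 2)%:Z.
  by rewrite -PoszD addnn divn2 even_halfK.
set h : int := (m %/ 2)%:Z in Em *.
have dvdN x : (m%:Z %| - x)%Z = (m%:Z %| x)%Z by rewrite !dvdzE abszN.
have dvdDm x : (m%:Z %| x + m%:Z)%Z = (m%:Z %| x)%Z by rewrite rpredDr // dvdzz.
have -> : j%:Z - (i%:Z + s) = - (i%:Z - (j%:Z - s)) by ring.
have -> : j%:Z - (i%:Z - s) = - (i%:Z - (j%:Z + s)) by ring.
have -> : j%:Z - (i%:Z + h) = - (i%:Z - (j%:Z + h) + m%:Z) by rewrite Em; ring.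
by rewrite !dvdN dvdDm orbCA.
Qed.

Lemma B1_sym (m : nat) (a b : int) : ~~ odd m -> symmetric (@B1 m a b).
Proof. by move=> m_even [i|i] [j|j] //=; exact: circ_adj_sym. Qed.

Lemma circ_adj_irr (m : nat) (s : int) :
  1 <= s -> s < (m %/ 2)%:Z -> irreflexive (@circ_adj m s).
Proof.
case: s => // s; rewrite lez_nat ltz_nat => s_gt0 s_lt i.
have m_gt0 : (0 < m)%N by exact: leq_ltn_trans (ltn_ord i).
have half_gt0 : (0 < m %/ 2)%N by exact: leq_ltn_trans s_lt.
have ndvd t : (0 < t)%N -> (t <= m %/ 2)%N -> (m %| t)%N = false.
  move=> t_gt0 t_le; apply: gtnNdvd => //; apply: leq_ltn_trans t_le _.
  exact: ltn_Pdiv.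
rewrite /circ_adj !eqz_mod_dvd !opprD !addrA subrr !add0r opprK.
by rewrite !dvdzE !abszN !absz_nat !ndvd // ltnW.
Qed.

Lemma B1_irr (m : nat) (a b : int) :
  1 <= a -> a <= b -> b < (m %/ 2)%:Z -> irreflexive (@B1 m a b).
Proof.
move=> a1 ab bm [i|i] /=; apply: circ_adj_irr => //.
  exact: le_lt_trans bm.
exact: le_trans ab.
Qed.

(* Main.v *)
(** Put h = m/2. The two circulant blocks are diagonalised by the characters
    k |-> w^k of Z/m, with w^m = 1; on such a character they act by
    l_a(w) = w^a + w^-a + w^h and l_b(w), so the characteristic polynomial is the
    product over w of (X - l_a(w))(X - l_b(w)) - 1. Since l_a, l_b are real, 0 is a
    simple root iff l_a(w) l_b(w) = 1 for exactly one w. The solution set is stable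
    under inversion and avoids 1, so the unique solution must be w = -1; the
    solutions i, -zeta_d with d = gcd(h, a, b), and -zeta_5 show the conditions to
    be necessary.

    Conversely, if h is odd and a, b are even, x = w^a and y = w^b are roots of
    unity of odd order and, with e = w^h = 1 or -1, the equation is the vanishing
    of the sum of the eight roots of unity x^(+-1) y^(+-1), e x^(+-1), e y^(+-1).
    For a prime p dividing the order N = pM, Galois conjugation z |-> z^(1 + kM)
    splits this sum along the cosets of the M-th roots of unity; comparing which
    terms share a coset leaves only x = y = 1 and the fifth roots of unity. *)

Require Import Defs.
From mathcomp Require Import all_boot all_order all_algebra all_field.
From mathcomp Require Import reals ring.

Set Implicit Arguments.
Unset Strict Implicit.
Unset Printing Implicit Defensive.

Import Order.TTheory GRing.Theory Num.Theory.
Local Open Scope ring_scope.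

(** * Vanishing sums of roots of unity split along cosets *)

Lemma sum_expr_unity (F : fieldType) (p : nat) (u : F) : u ^+ p = 1 ->
  \sum_(k < p) u ^+ k = if u == 1 then p%:R else 0.
Proof.
move=> up; have := subrX1 u p; rewrite up subrr => /esym/eqP.
rewrite mulf_eq0 subr_eq0; case: (eqVneq u 1) => [-> _|_ /eqP //].
by rewrite (eq_bigr (fun=> 1)) ?sumr_const ?card_ord // => k _; rewrite expr1n.
Qed.

(* The coset of t modulo the M-th roots of unity is recorded by t^M. *)
Definition coset_sum (M : nat) (s : seq (int * algC)) (r : algC) : algC :=
  \sum_(u <- s) if u.2 ^+ M == r then u.1%:~R * u.2 else 0.

(* The conjugates z |-> z^(1 + kM), for p not dividing 1 + kM, multiply the r-part
   of the vanishing sum by r^k; inverting this Fourier transform on Z/p, at most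
   one k is missing, and none is when p divides M. *)
Lemma coset_sums (p M : nat) (s : seq (int * algC)) :
    prime p -> (0 < M)%N -> all (fun u => u.2 ^+ (p * M) == 1) s ->
    \sum_(u <- s) u.1%:~R * u.2 = 0 ->
  exists k : nat, forall r, r ^+ p = 1 ->
    coset_sum M s r = r^-1 ^+ k * coset_sum M s 1 /\
    ((p %| M)%N -> coset_sum M s r = 0).
Proof.
move=> p_pr M_gt0 /allP s1 sum0; have p_gt0 := prime_gt0 p_pr.
pose Q k : algC := \sum_(u <- s) u.1%:~R * u.2 ^+ (1 + k * M).
have Q0 k : ~~ (p %| 1 + k * M)%N -> Q k = 0.
  move=> ndv; have co : coprime (1 + k * M) (p * M).
    rewrite coprimeMr coprime_sym prime_coprime // ndv /=.
    by rewrite coprime_sym /coprime addnC gcdnMDl gcdn1.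
  have [f fE] := Qn_aut_exists co.
  have := congr1 f sum0; rewrite rmorph0 rmorph_sum /= => <-.
  apply: eq_big_seq => u us; rewrite rmorphM rmorph_int /= fE //.
  exact/eqP/s1.
have SE r : r ^+ p = 1 ->
    p%:R * coset_sum M s r = \sum_(k < p) r^-1 ^+ k * Q k.
  move=> rp; have r0 : r != 0.
    apply: contraTneq (oner_neq0 algC) => r0.
    by rewrite -rp r0 expr0n gtn_eqF ?eqxx.
  under eq_bigr do rewrite mulr_sumr.
  rewrite exchange_big mulr_sumr; apply: eq_big_seq => u us /=.
  transitivity (u.1%:~R * u.2 * \sum_(k < p) (r^-1 * u.2 ^+ M) ^+ k); last first.
    rewrite mulr_sumr; apply: eq_bigr => k _.
    by rewrite exprMn -exprM [(M * k)%N]mulnC exprD expr1 !mulrA;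
      congr (_ * _); rewrite mulrC mulrA.
  rewrite sum_expr_unity; last first.
    by rewrite exprMn exprVn rp invr1 mul1r -exprM mulnC; apply/eqP/s1.
  have -> : (r^-1 * u.2 ^+ M == 1) = (u.2 ^+ M == r).
    by rewrite mulrC -(inj_eq (mulIf r0)) mulfVK // mul1r.
  by case: ifP => _; rewrite ?mulr0 // mulrC.
have pn0 : p%:R != 0 :> algC by rewrite pnatr_eq0 -lt0n.
case: (pickP (fun k : 'I_p => (p %| 1 + k * M)%N)) => [k0 dv0|ndv].
  exists k0 => r rp.
  have Qk (k : 'I_p) : k != k0 -> Q k = 0.
    move=> kk0; apply: Q0; apply: contra kk0 => dvk.
    (* Two indices with p | 1 + kM have difference divisible by p, since p | M would give p | 1;
       both lie below p, so they agree. *)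
    wlog le : k k0 dv0 dvk / (k <= k0)%N => [W|].
      by case: (leqP k k0) => [|/ltnW] /W; rewrite eq_sym => -> //; rewrite eq_sym.
    have : (p %| (1 + k0 * M) - (1 + k * M))%N by rewrite dvdn_sub.
    rewrite subnDl -mulnBl Euclid_dvdM // => /orP[|pM].
      case: (posnP (k0 - k)%N) => [/eqP|kk /(dvdn_leq kk)].
        by rewrite subn_eq0 -val_eqE eqn_leq le /=.
      by rewrite leqNgt (leq_ltn_trans (leq_subr _ _)).
    by move: dvk; rewrite dvdn_addl ?dvdn_mull // dvdn1 => /eqP p1; rewrite p1 in p_pr.
  (* Only the term k0 survives the inversion; t = 1 identifies [Q k0] as p times the sum over the
     coset of 1. *)
  have E t : t ^+ p = 1 -> p%:R * coset_sum M s t = t^-1 ^+ k0 * Q k0.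
    by move=> tp; rewrite SE // (bigD1 k0) //= big1 ?addr0 // => k /Qk->; rewrite mulr0.
  split=> [|pM].
    apply: (mulfI pn0); rewrite E // mulrCA (E 1) ?expr1n //.
    by rewrite invr1 expr1n mul1r.
  by move: dv0; rewrite dvdn_addl ?dvdn_mull // dvdn1 => /eqP p1; rewrite p1 in p_pr.
have S0 r : r ^+ p = 1 -> coset_sum M s r = 0.
  move=> rp; apply: (mulfI pn0); rewrite SE // mulr0 big1 // => k _.
  by rewrite Q0 ?mulr0 // ndv.
by exists 0%N => r rp; rewrite !S0 ?expr1n ?mulr0.
Qed.

(** * The eight-term equation for roots of unity of odd order *)

Lemma odd_unity_neqN1 (N : nat) (t : algC) : odd N -> t ^+ N = 1 -> t != -1.
Proof.
move=> oddN tN; apply: contra_eq_neq tN => ->; rewrite -signr_odd oddN.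
by rewrite eq_sym -subr_eq0 opprK -mulr2n pnatr_eq0.
Qed.

Lemma unity_neq0 (F : fieldType) (N : nat) (t : F) : (0 < N)%N -> t ^+ N = 1 -> t != 0.
Proof.
move=> N0 tN; apply: contra_eq_neq tN => ->.
by rewrite expr0n gtn_eqF // eq_sym oner_neq0.
Qed.

Lemma prime_unity_dvd (p k : nat) (t : algC) :
  prime p -> t ^+ p = 1 -> t != 1 -> t ^+ k = 1 -> (p %| k)%N.
Proof.
move=> p_pr tp t1 tk; have [n n_prim n_dv] := prim_order_exists (prime_gt0 p_pr) tp.
case/primeP: p_pr => _ /(_ n n_dv) /orP[] /eqP nE; subst n.
  by move: t1; rewrite -[t]expr1 -(prim_order_dvd n_prim).
by rewrite (prim_order_dvd n_prim) tk.
Qed.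

(** The expansion of (x + 1/x + e)(y + 1/y + e) - e^2. The sign e stays an integer coefficient, so
    that Galois conjugation fixes it and the roots themselves keep odd order. *)
Definition nut_terms (e : int) (x y : algC) : seq (int * algC) :=
  [:: (1, x * y); (1, x * y^-1); (1, x^-1 * y); (1, x^-1 * y^-1);
      (e, x); (e, x^-1); (e, y); (e, y^-1)].

Definition nut_eq (e : int) (x y : algC) : Prop :=
  (x + x^-1 + e%:~R) * (y + y^-1 + e%:~R) = 1.

Lemma sqr_sign_int (e : int) : e = 1 \/ e = -1 -> e%:~R ^+ 2 = 1 :> algC.
Proof. by case=> ->; rewrite ?rmorphN ?sqrrN rmorph1 expr1n. Qed.

Lemma nut_eqC e x y : nut_eq e x y -> nut_eq e y x.
Proof. by rewrite /nut_eq mulrC. Qed.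

Lemma nut_eqV e x y : nut_eq e x y -> nut_eq e x y^-1.
Proof. by rewrite /nut_eq invrK [y^-1 + y]addrC. Qed.

Lemma sum_nut_terms e x y : x != 0 -> y != 0 -> e = 1 \/ e = -1 ->
  nut_eq e x y -> \sum_(u <- nut_terms e x y) u.1%:~R * u.2 = 0.
Proof.
move=> x0 y0 /sqr_sign_int e2 exy.
transitivity ((x + x^-1 + e%:~R) * (y + y^-1 + e%:~R) - e%:~R ^+ 2).
  by rewrite !big_cons big_nil /=; field; rewrite x0 y0.
by rewrite e2 exy subrr.
Qed.

Lemma coset_sumE M e x y r (A := x ^+ M) (B := y ^+ M) :
  coset_sum M (nut_terms e x y) r =
    (if A * B == r then x * y else 0) + (if A / B == r then x / y else 0) +
    (if A^-1 * B == r then x^-1 * y else 0) +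
    (if A^-1 / B == r then x^-1 / y else 0) +
    (if A == r then e%:~R * x else 0) + (if A^-1 == r then e%:~R * x^-1 else 0) +
    (if B == r then e%:~R * y else 0) + (if B^-1 == r then e%:~R * y^-1 else 0).
Proof.
by rewrite /coset_sum !big_cons big_nil /= !exprMn !exprVn !mul1r addr0 !addrA.
Qed.

(** Inverting y only permutes the eight terms. A case on y^M is thereby settled together with the
    case of its inverse. *)
Lemma coset_sumV M e x y r :
  coset_sum M (nut_terms e x y^-1) r = coset_sum M (nut_terms e x y) r.
Proof. by rewrite !coset_sumE !exprVn !invrK [LHS](ACl (2*1*4*3*5*6*8*7)). Qed.

(** A certificate that two coset labels differ: a difference known to be nonzero is a multiple of l
    - r. Each use supplies the cofactor s, and [field] checks the identity. *)
Lemma eqF_of_diff (F : fieldType) (u v l r s : F) :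
  u != v -> u - v = (l - r) * s -> (l == r) = false.
Proof.
move=> uv E; apply/eqP => lr; case/negP: uv.
by rewrite -subr_eq0 E lr subrr mul0r.
Qed.

(** Put A = x^M and B = y^M. The term e x cannot be alone in the coset of A, so another label equals
    A. Everything except B = A^2 and B = A^-2 is excluded, and these two lead to p = 5. *)
Lemma zero_coset_sums (p M : nat) (e : int) (x y : algC) :
    prime p -> odd (p * M) -> x ^+ (p * M) = 1 -> y ^+ (p * M) = 1 ->
    e = 1 \/ e = -1 -> nut_eq e x y -> x ^+ M != 1 ->
    (forall r, r ^+ p = 1 -> coset_sum M (nut_terms e x y) r = 0) ->
  [/\ p = 5%N, x ^+ 5 = 1 & y = x ^+ 2 \/ y = x ^- 2].
Proof.
move=> p_pr oN xN yN e1 exy A1 S0.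
have N0 : (0 < p * M)%N by case: (p * M)%N oN.
have x0 := unity_neq0 N0 xN; have y0 := unity_neq0 N0 yN.
have e2 := sqr_sign_int e1.
have e0 : e%:~R != 0 :> algC by rewrite -sqrf_eq0 e2 oner_neq0.
set A := x ^+ M in A1.
have Ap : A ^+ p = 1 by rewrite -exprM mulnC.
have A0 : A != 0 by rewrite expf_neq0.
have Ak k : (0 < k < p)%N -> A ^+ k != 1.
  case/andP=> k0 kp; apply: contraL kp => /eqP /(prime_unity_dvd p_pr Ap A1).
  by move/(dvdn_leq k0); rewrite leqNgt.
have p2 : (2 < p)%N.
  by rewrite ltn_neqAle prime_gt1 // andbT; apply: contraTneq oN => <-; rewrite oddM.
have A2 : A ^+ 2 != 1 by rewrite Ak.
(* t^2 = -1 would force t to have even order *)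
have sq (t : algC) : t ^+ (p * M) = 1 -> t + t^-1 != 0.
  move=> tN; have t0 := unity_neq0 N0 tN.
  have : (t ^+ 2) ^+ (p * M) = 1 by rewrite -exprM mulnC exprM tN expr1n.
  move/(odd_unity_neqN1 oN); apply: contra_neq => E.
  by apply/eqP; rewrite -subr_eq0; apply/eqP;
    transitivity ((t + t^-1) * t); [field | rewrite E mul0r].
(* If z^M = 1, the coset of A sums to x(z + 1/z + e), whose vanishing contradicts the equation. If
   z^M = A, the coset of 1 sums to x/z + z/x, which is nonzero by [sq]. *)
have W1 (z : algC) : z ^+ (p * M) = 1 -> nut_eq e x z ->
    (forall r, r ^+ p = 1 -> coset_sum M (nut_terms e x z) r = 0) ->
    z ^+ M != 1 /\ z ^+ M != A.
  move=> zN exz {}S0; have z0 := unity_neq0 N0 zN.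
  set B := z ^+ M; have B0 : B != 0 by rewrite expf_neq0.
  have B1 : B != 1.
    apply/negP => /eqP BE; have := S0 A Ap; rewrite coset_sumE -/A -/B BE invr1 !mulr1 eqxx.
    rewrite (_ : A^-1 == A = false);
      last by apply: (eqF_of_diff (s := - A) A2); field; rewrite ?A0 ?B0.
    rewrite eq_sym (negbTE A1) !addr0 => E.
    have E1 : z + z^-1 + e%:~R = 0.
      by apply: (mulfI x0); rewrite mulr0 -E; ring.
    by move: exz; rewrite /nut_eq E1 mulr0 => /esym/eqP; rewrite oner_eq0.
  split=> //.
    apply/negP => /eqP BE; have := S0 1 (expr1n _ _); rewrite coset_sumE -/A -/B BE.
    rewrite mulfV // mulVf // eqxx.
    rewrite (_ : A * A == 1 = false); last exact/negbTE.
    rewrite (_ : A^-1 / A == 1 = false);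
      last by apply: (eqF_of_diff (s := - A ^+ 2) A2); field; rewrite ?A0 ?B0.
    rewrite (_ : A^-1 == 1 = false) ?invr_eq1 ?(negbTE A1) // add0r !addr0 => E.
    have /sq/eqP[] : (x / z) ^+ (p * M) = 1 by rewrite exprMn exprVn xN zN invr1 mulr1.
    by rewrite invf_div mulrC [_^-1 * _]mulrC -{}E mulrC [z / _]mulrC.
have yVN : y^-1 ^+ (p * M) = 1 by rewrite exprVn yN invr1.
have S0V r : r ^+ p = 1 -> coset_sum M (nut_terms e x y^-1) r = 0.
  by move=> rp; rewrite coset_sumV S0.
(* In the coset of A only z/x and e x remain, so z = -e x^2; as z/x^2 has odd order, e = -1. *)
have W2 (z : algC) : z ^+ (p * M) = 1 -> z ^+ M != A^-1 ->
    (forall r, r ^+ p = 1 -> coset_sum M (nut_terms e x z) r = 0) ->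
    z ^+ M = A ^+ 2 -> [/\ p = 5%N, x ^+ 5 = 1 & z = x ^+ 2].
  move=> zN + {}S0 BE; rewrite BE => A3'.
  have A3 : A ^+ 3 != 1.
    by apply: contra_neq A3' => A3; apply: (mulfI A0); rewrite -exprS A3 mulfV.
  have p3 : (3 < p)%N.
    by rewrite ltn_neqAle p2 andbT; apply: contra_neq A3 => ->.
  have A4 : A ^+ 4 != 1.
    apply: contraL p3 => /eqP /(prime_unity_dvd p_pr Ap A1) p4.
    by move: p4 p_pr oN; case: (p) => [|[|[|[|[|q]]]]] // /(dvdn_leq _) -/(_ isT).
  have z0 := unity_neq0 N0 zN.
  have [zx2 e1'] : z = x ^+ 2 /\ e%:~R = -1 :> algC.
    have := S0 A Ap; rewrite coset_sumE -/A BE.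
    rewrite (_ : A * A ^+ 2 == A = false);
      last by apply: (eqF_of_diff (s := A^-1) A2); field; rewrite ?A0.
    rewrite (_ : A / A ^+ 2 == A = false);
      last by apply: (eqF_of_diff (s := - A) A2); field; rewrite ?A0.
    rewrite (_ : A^-1 * A ^+ 2 == A); last by rewrite expr2 mulKf.
    rewrite (_ : A^-1 / A ^+ 2 == A = false);
      last by apply: (eqF_of_diff (s := - A ^+ 3) A4); field; rewrite ?A0.
    rewrite eqxx (_ : A^-1 == A = false);
      last by apply: (eqF_of_diff (s := - A) A2); field; rewrite ?A0.
    rewrite (_ : A ^+ 2 == A = false);
      last by apply: (eqF_of_diff (s := A^-1) A1); field; rewrite ?A0.
    rewrite (_ : A ^- 2 == A = false);
      last by apply: (eqF_of_diff (s := - A ^+ 2) A3); field; rewrite ?A0.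
    rewrite !(add0r, addr0) => E.
    have {E} : z = - e%:~R * x ^+ 2.
      apply/eqP; rewrite -subr_eq0; apply/eqP.
      by transitivity ((x^-1 * z + e%:~R * x) * x); [field | rewrite E mul0r].
    case: e1 => -> zE; last by rewrite zE rmorphN rmorph1 opprK mul1r.
    have : (z / x ^+ 2) ^+ (p * M) = 1.
      by rewrite exprMn exprVn zN -exprM mulnC exprM xN expr1n invr1 mulr1.
    move/(odd_unity_neqN1 oN)/eqP; case.
    by rewrite zE rmorph1 mulfK // expf_neq0.
  (* In the coset of A^2 the term e z can be cancelled only by 1/(xz), whose label is A^-3. Hence
     A^5 = 1, and the cancellation itself reads x^5 = 1. *)
  have := S0 (A ^+ 2); rewrite -exprM mulnC exprM Ap expr1n => /(_ erefl).
  rewrite coset_sumE -/A BE.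
  rewrite (_ : A * A ^+ 2 == A ^+ 2 = false);
    last by apply: (eqF_of_diff (s := A^-2) A1); field; rewrite ?A0.
  rewrite (_ : A / A ^+ 2 == A ^+ 2 = false);
    last by apply: (eqF_of_diff (s := - A) A3); field; rewrite ?A0.
  rewrite (_ : A^-1 * A ^+ 2 == A ^+ 2 = false);
    last by apply: (eqF_of_diff (s := - A^-1) A1); field; rewrite ?A0.
  rewrite (_ : A == A ^+ 2 = false);
    last by apply: (eqF_of_diff (s := - A^-1) A1); field; rewrite ?A0.
  rewrite (_ : A^-1 == A ^+ 2 = false);
    last by apply: (eqF_of_diff (s := - A) A3); field; rewrite ?A0.
  rewrite eqxx (_ : A ^- 2 == A ^+ 2 = false);
    last by apply: (eqF_of_diff (s := - A ^+ 2) A4); field; rewrite ?A0.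
  case: eqP => [A5|_]; rewrite !(add0r, addr0); last first.
    by move/eqP; rewrite mulf_eq0 (negbTE e0) (negbTE z0).
  rewrite e1' zx2 => E; split=> //.
    have A5' : A ^+ 5 = 1 by rewrite (exprD _ 2 3) -A5; field.
    by apply/eqP; rewrite -dvdn_prime2 // (prime_unity_dvd p_pr Ap A1).
  apply/eqP; rewrite -subr_eq0; apply/eqP.
  by transitivity (- (x^-1 / x ^+ 2 + -1 * x ^+ 2) * x ^+ 3);
    [field | rewrite E oppr0 mul0r].
have [B1 BA] := W1 y yN exy S0.
have [_] := W1 y^-1 yVN (nut_eqV exy) S0V.
case: (eqVneq (y ^+ M) (A ^+ 2)) => [BE|nB2] BVA.
  have [] := W2 y yN _ S0 BE; last by split=> //; left.
  by apply: contra_neq BVA; rewrite exprVn => ->; rewrite invrK.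
case: (eqVneq (y^-1 ^+ M) (A ^+ 2)) => [BE|nBV2].
  have [] := W2 y^-1 yVN _ S0V BE.
    by apply: contra_neq BA; rewrite exprVn => /invr_inj ->.
  by move=> ? ? /(canRL (@invrK _)) ->; split=> //; right.
(* With B distinct from 1 and from A, A^2 and their inverses, e x is alone in the coset of A. *)
move: BVA nBV2; rewrite exprVn; set B := y ^+ M in B1 BA nB2 * => BV nBV2.
have B0 : B != 0 by rewrite expf_neq0.
have := S0 A Ap; rewrite coset_sumE -/A -/B eqxx.
rewrite (_ : A * B == A = false);
  last by apply: (eqF_of_diff (s := A^-1) B1); field; rewrite ?A0 ?B0.
rewrite (_ : A / B == A = false);
  last by apply: (eqF_of_diff (s := - B / A) B1); field; rewrite ?A0 ?B0.
rewrite (_ : A^-1 * B == A = false);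
  last by apply: (eqF_of_diff (s := A) nB2); field; rewrite ?A0 ?B0.
rewrite (_ : A^-1 / B == A = false);
  last by apply: (eqF_of_diff (s := A) nBV2); field; rewrite ?A0 ?B0.
rewrite (_ : A^-1 == A = false);
  last by apply: (eqF_of_diff (s := - A) A2); field; rewrite ?A0 ?B0.
rewrite (negbTE BA) (negbTE BV) !(add0r, addr0) => /eqP.
by rewrite mulf_eq0 (negbTE e0) (negbTE x0).
Qed.
(** When p does not divide M, all coset sums are unit multiples of each other, so one vanishing sum
    suffices; it is sought at a p-th root of unity t that is the label of no term. *)
Lemma coset_sums_eq0 (p M : nat) (e : int) (x y : algC) :
    prime p -> (4 < p)%N || (p %| M)%N -> odd (p * M) ->
    x ^+ (p * M) = 1 -> y ^+ (p * M) = 1 ->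
    e = 1 \/ e = -1 -> nut_eq e x y -> x ^+ M != 1 ->
  forall r, r ^+ p = 1 -> coset_sum M (nut_terms e x y) r = 0.
Proof.
move=> p_pr p_big oN xN yN e1 exy A1.
have N0 : (0 < p * M)%N by case: (p * M)%N oN.
have M0 : (0 < M)%N by move: N0; rewrite muln_gt0 => /andP[].
have x0 := unity_neq0 N0 xN; have y0 := unity_neq0 N0 yN.
have all1 : all (fun u => u.2 ^+ (p * M) == 1) (nut_terms e x y).
  by rewrite /= !exprMn !exprVn xN yN invr1 mulr1 eqxx.
have [k Sk] := coset_sums p_pr M0 all1 (sum_nut_terms x0 y0 e1 exy).
case: (boolP (p %| M)%N) => [pM|npM] r rp; first by case: (Sk r rp) => _ ->.
have {npM p_big} p4 : (4 < p)%N by move: p_big; rewrite (negbTE npM) orbF.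
suff [t tp St] : exists2 t, t ^+ p = 1 & coset_sum M (nut_terms e x y) t = 0.
  have [-> _] := Sk r rp; have [+ _] := Sk t tp; rewrite St => /esym/eqP.
  rewrite mulf_eq0 => /orP[|/eqP ->]; last by rewrite mulr0.
  rewrite expf_eq0 invr_eq0 => /andP[_ /eqP t0].
  by move/eqP: tp; rewrite t0 expr0n gtn_eqF ?prime_gt0 // eq_sym oner_eq0.
set A := x ^+ M in A1; set B := y ^+ M.
have Ap : A ^+ p = 1 by rewrite -exprM mulnC.
have A0 : A != 0 by rewrite expf_neq0.
have B0 : B != 0 by rewrite expf_neq0.
have Ak j : (0 < j < p)%N -> A ^+ j != 1.
  case/andP=> j0 jp; apply: contraL jp => /eqP /(prime_unity_dvd p_pr Ap A1).
  by move/(dvdn_leq j0); rewrite leqNgt.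
have A2 : A ^+ 2 != 1 by rewrite Ak ?(leq_trans _ p4).
have A3 : A ^+ 3 != 1 by rewrite Ak ?(leq_trans _ p4).
have A4 : A ^+ 4 != 1 by rewrite Ak ?(leq_trans _ p4).
have Ajp j : (A ^+ j) ^+ p = 1 by rewrite exprAC Ap expr1n.
(* The labels are 1, A and 1/A here, so t = A^2 is free. Below, if B is none of 1, A, 1/A, then t =
   1 is free; the case B = 1/A reduces to B = A. *)
case: (eqVneq B 1) => [BE|B1].
  exists (A ^+ 2); first exact: Ajp.
  rewrite coset_sumE -/A -/B BE invr1 !mulr1 [1 == _]eq_sym (negbTE A2).
  rewrite (_ : A == A ^+ 2 = false);
    last by apply: (eqF_of_diff (s := - A^-1) A1); field; rewrite ?A0.
  rewrite (_ : A^-1 == A ^+ 2 = false);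
    last by apply: (eqF_of_diff (s := - A) A3); field; rewrite ?A0.
  by rewrite !addr0.
suff W (z : algC) : z ^+ (p * M) = 1 -> nut_eq e x z ->
    (forall r, r ^+ p = 1 -> coset_sum M (nut_terms e x z) r =
      r^-1 ^+ k * coset_sum M (nut_terms e x z) 1) ->
    z ^+ M = A -> exists2 t, t ^+ p = 1 & coset_sum M (nut_terms e x z) t = 0.
  case: (eqVneq B A) => [|BA].
    by apply: W => // q qp; case: (Sk q qp).
  case: (eqVneq B A^-1) => [BVA|BVA].
    have [||||t tp] := W y^-1.
    - by rewrite exprVn yN invr1.
    - exact: nut_eqV.
    - by move=> q qp; rewrite !coset_sumV; case: (Sk q qp).
    - by rewrite exprVn -/B BVA invrK.
    by rewrite coset_sumV; exists t.
  exists 1; first by rewrite expr1n.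
  rewrite coset_sumE -/A -/B.
  rewrite (_ : A * B == 1 = false);
    last by apply: (eqF_of_diff (s := A^-1) BVA); field; rewrite ?A0.
  rewrite (_ : A / B == 1 = false);
    last by apply: (eqF_of_diff (s := - B) BA); field; rewrite ?B0.
  rewrite (_ : A^-1 * B == 1 = false);
    last by apply: (eqF_of_diff (s := A) BA); field; rewrite ?A0.
  rewrite (_ : A^-1 / B == 1 = false);
    last by apply: (eqF_of_diff (s := - B) BVA); field; rewrite ?A0 ?B0.
  by rewrite !invr_eq1 (negbTE A1) (negbTE B1) !addr0.
move=> {y yN exy Sk y0 all1 B B0 B1} zN exz Sk BE; have z0 := unity_neq0 N0 zN.
have SA t (B := z ^+ M) : coset_sum M (nut_terms e x z) t =
    (if A ^+ 2 == t then x * z else 0) + (if 1 == t then x / z + z / x else 0) +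
    (if A ^- 2 == t then x^-1 / z else 0) + (if A == t then e%:~R * (x + z) else 0) +
    (if A^-1 == t then e%:~R * (x^-1 + z^-1) else 0).
  rewrite coset_sumE -/A BE mulfV // mulVf // -expr2 -expr2 exprVn.
  by case: eqP => _; case: eqP => _; case: eqP => _; case: eqP => _; case: eqP => _; ring.
(* The labels are now the powers of A from -2 to 2: A^3 is free for p > 5, while for p = 5 all fifth
   roots of unity are labels and a contradiction is derived instead. *)
case: (ltnP 5 p) => [p6|p5].
  have A5 : A ^+ 5 != 1 by rewrite Ak ?(leq_trans _ p6).
  exists (A ^+ 3); first exact: Ajp.
  rewrite SA [1 == _]eq_sym (negbTE A3).
  rewrite (_ : A ^+ 2 == A ^+ 3 = false);
    last by apply: (eqF_of_diff (s := - A ^- 2) A1); field; rewrite ?A0.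
  rewrite (_ : A ^- 2 == A ^+ 3 = false);
    last by apply: (eqF_of_diff (s := - A ^+ 2) A5); field; rewrite ?A0.
  rewrite (_ : A == A ^+ 3 = false);
    last by apply: (eqF_of_diff (s := - A^-1) A2); field; rewrite ?A0.
  rewrite (_ : A^-1 == A ^+ 3 = false);
    last by apply: (eqF_of_diff (s := - A) A4); field; rewrite ?A0.
  by rewrite !addr0.
exfalso.
have S1 : coset_sum M (nut_terms e x z) 1 = x / z + z / x.
  by rewrite SA eqxx !invr_eq1 (negbTE A1) (negbTE A2) !addr0 add0r.
set C := x / z + z / x in S1.
have := Sk (A ^+ 2) (Ajp _); rewrite S1 SA eqxx [1 == _]eq_sym (negbTE A2).
rewrite (_ : A ^- 2 == A ^+ 2 = false);
  last by apply: (eqF_of_diff (s := - A ^+ 2) A4); field; rewrite ?A0.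
rewrite (_ : A == A ^+ 2 = false);
  last by apply: (eqF_of_diff (s := - A^-1) A1); field; rewrite ?A0.
rewrite (_ : A^-1 == A ^+ 2 = false);
  last by apply: (eqF_of_diff (s := - A) A3); field; rewrite ?A0.
rewrite !addr0 => E2.
have A2Vp : A ^- 2 ^+ p = 1 by rewrite exprVn Ajp invr1.
have := Sk _ A2Vp; rewrite S1 SA eqxx invrK.
rewrite [1 == _]eq_sym invr_eq1 (negbTE A2).
rewrite (_ : A ^+ 2 == A ^- 2 = false);
  last by apply: (eqF_of_diff (s := A ^+ 2) A4); field; rewrite ?A0.
rewrite (_ : A == A ^- 2 = false);
  last by apply: (eqF_of_diff (s := A ^+ 2) A3); field; rewrite ?A0.
rewrite (_ : A^-1 == A ^- 2 = false);
  last by apply: (eqF_of_diff (s := A ^+ 2) A1); field; rewrite ?A0.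
rewrite !addr0 !add0r => E3.
(* The cosets of A^2 and A^-2 give xz = C/D and 1/(xz) = CD, so C^2 = 1. Being a root of unity of
   odd order, C is 1; then u = x/z satisfies u + 1/u = 1, whence u^3 = -1, against odd order. *)
set D := (A ^+ 2) ^+ k in E3; rewrite exprVn -/D in E2.
have D0 : D != 0 by rewrite !expf_neq0.
have DN : D ^+ (p * M) = 1 by rewrite exprM [D ^+ p]exprAC Ajp !expr1n.
have C2 : C ^+ 2 = 1.
  transitivity ((D^-1 * C) * (D * C)); first by field.
  by rewrite -E2 -E3; field; rewrite x0 z0.
have CN : C ^+ (p * M) = 1.
  have -> : C = x * z * D by rewrite E2; field.
  by rewrite !exprMn xN zN DN !mulr1.
move/eqP: C2; rewrite sqrf_eq1 (negbTE (odd_unity_neqN1 oN CN)) orbF => /eqP C1.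
have uN : ((x / z) ^+ 3) ^+ (p * M) = 1.
  by rewrite exprAC exprMn exprVn xN zN invr1 mulr1 expr1n.
case/eqP: (odd_unity_neqN1 oN uN); apply/eqP; rewrite -subr_eq0; apply/eqP.
transitivity ((1 - C) * - (x / z) * (x / z + 1)); last by rewrite C1 subrr !mul0r.
by rewrite /C; field; rewrite x0 z0.
Qed.
(** For t^3 = 1 the sum t + 1/t is 2 or -1. So both factors lie in {3, 0} if e = 1 and in {1, -2} if
    e = -1, and the product is 1 only as 1 * 1. *)
Lemma nut_eq_cube e x y : e = 1 \/ e = -1 -> nut_eq e x y ->
  x ^+ 3 = 1 -> y ^+ 3 = 1 -> [/\ x = 1, y = 1 & e = -1].
Proof.
have cube (t : algC) : t ^+ 3 = 1 -> t = 1 \/ t + t^-1 = -1.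
  move=> t3; have t0 := unity_neq0 (isT : 0 < 3)%N t3.
  case: (eqVneq t 1) => t1; [by left | right].
  have tt : t ^+ 2 + t + 1 = 0.
    apply: (mulfI (_ : t - 1 != 0)); first by rewrite subr_eq0.
    by rewrite mulr0 -[RHS](subrr 1) -[X in _ = X - _]t3; ring.
  apply: (mulIf t0); rewrite mulrDl mulVf // -[LHS](addrK t) -expr2.
  by rewrite [_ + 1 + t]addrAC tt; ring.
have absurd n : n.+1%:R = 0 :> algC -> False by move/eqP; rewrite pnatr_eq0.
have n1 : (-1)%:~R = -1 :> algC by rewrite rmorphN rmorph1.
move=> e1 + /cube Hx /cube Hy; rewrite /nut_eq.
case: Hx => [->|->]; case: Hy => [->|->]; rewrite ?invr1;
  case: e1 => ->; rewrite ?n1 ?rmorph1 => E //.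
- by case: (absurd 7); rewrite -[RHS](subrr 1) -[X in _ = X - _]E; ring.
- by case: (absurd 0); rewrite -[LHS]E; ring.
- by case: (absurd 2); rewrite -[RHS](subrr 1) -[X in _ = _ - X]E; ring.
- by case: (absurd 0); rewrite -[LHS]E; ring.
- by case: (absurd 2); rewrite -[RHS](subrr 1) -[X in _ = _ - X]E; ring.
- by case: (absurd 0); rewrite -[LHS]E; ring.
- by case: (absurd 2); rewrite -[RHS](subrr 1) -[X in _ = X - _]E; ring.
Qed.

(** Supplies the prime for [coset_sums_eq0]: at least 5, or with square dividing N. An odd N without
    such a prime is 1 or 3. *)
Lemma odd_big_prime_factor (N : nat) : odd N -> ~~ (N %| 3)%N ->
  exists p M, [/\ prime p, N = (p * M)%N & (4 < p)%N || (p %| M)%N].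
Proof.
have small q : prime q -> odd q -> ~~ (4 < q)%N -> q = 3%N.
  by case: q => [|[|[|[|[|q]]]]].
move=> oN N3; have N1 : (1 < N)%N by case: N oN N3 => [|[|]].
have /dvdnP[M] := pdiv_dvd N; set p := pdiv N; rewrite mulnC => NE.
have p_pr : prime p by rewrite pdiv_prime.
case: (boolP (4 < p)%N) => p4; first by exists p, M; rewrite p4.
have p3 : p = 3%N by apply: small => //; move: oN; rewrite NE oddM => /andP[].
have M1 : (1 < M)%N.
  by move: oN N3; rewrite NE p3; case: (M) => [|[|]].
have q_pr := pdiv_prime M1; have qM := pdiv_dvd M; have /dvdnP[K ME] := qM.
have oq : odd (pdiv M).
  by apply: dvdn_odd qM _; move: oN; rewrite NE oddM => /andP[].
case: (boolP (4 < pdiv M)%N) => q4.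
  by exists (pdiv M), (p * K)%N; split; rewrite ?q4 // NE [in LHS]ME mulnA mulnC.
by exists p, M; split; rewrite // orbC {1}p3 -(small _ q_pr oq q4) qM.
Qed.

(** The hypothesis on k makes N the exponent of the group generated by x and y. Hence for N = pM one
    of x^M, y^M differs from 1, and by symmetry it may be taken to be x^M. *)
Lemma nut_eq_odd_unity (N : nat) (e : int) (x y : algC) :
    odd N -> x ^+ N = 1 -> y ^+ N = 1 ->
    (forall k, x ^+ k = 1 -> y ^+ k = 1 -> (N %| k)%N) ->
    e = 1 \/ e = -1 -> nut_eq e x y ->
  [/\ x = 1, y = 1 & e = -1] \/
  [/\ x ^+ 5 = 1 /\ y ^+ 5 = 1, x != 1, y != 1, x != y & x * y != 1].
Proof.
move=> oN xN yN gen e1 exy; case: (boolP (N %| 3)%N) => [N3|].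
  by left; apply: nut_eq_cube => //; case/dvdnP: N3 => q ->;
     rewrite mulnC exprM ?xN ?yN expr1n.
case/odd_big_prime_factor=> // p [M] [p_pr NE p_big]; rewrite NE in oN xN yN gen.
have M0 : (0 < M)%N by move: oN; case: (M); rewrite ?muln0.
suff W u v : u ^+ (p * M) = 1 -> v ^+ (p * M) = 1 -> nut_eq e u v -> u ^+ M != 1 ->
  [/\ u ^+ 5 = 1 /\ v ^+ 5 = 1, u != 1, v != 1, u != v & u * v != 1].
  right; case: (eqVneq (x ^+ M) 1) => [xM|xM]; last exact: W.
  case: (eqVneq (y ^+ M) 1) => [yM|yM].
    have := dvdn_leq M0 (gen M xM yM); rewrite leqNgt ltn_Pmull //.
    exact: prime_gt1.
  have [[y5 x5] ? ? yx yx1] := W y x yN xN (nut_eqC exy) yM.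
  by split; rewrite // ?[x == y]eq_sym // mulrC.
move=> {x y xN yN gen exy} xN yN exy xM.
have S0 := coset_sums_eq0 p_pr p_big oN xN yN e1 exy xM.
have [p5 x5 yx] := zero_coset_sums p_pr oN xN yN e1 exy xM S0.
have x1 : u != 1 by apply: contra_neq xM => ->; rewrite expr1n.
have x0 := unity_neq0 (isT : 0 < 5)%N x5.
have xk k : (0 < k < 5)%N -> u ^+ k != 1.
  case/andP=> k0 kp; apply: contraL kp => /eqP.
  move/(prime_unity_dvd (isT : prime 5) x5 x1)/(dvdn_leq k0).
  by rewrite leqNgt.
have [x2 x3] : u ^+ 2 != 1 /\ u ^+ 3 != 1 by split; exact: xk.
case: yx => ->; split.
- by rewrite exprAC x5 expr1n.
- by [].
- by [].
- by rewrite eq_sym; apply/negbT/(eqF_of_diff (s := u^-1) x1); field.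
- by rewrite -exprS.
- by rewrite exprVn exprAC x5 expr1n invr1.
- by [].
- by rewrite invr_eq1.
- by apply/negbT/(eqF_of_diff (s := u ^+ 2) x3); field.
- by apply/negbT/(eqF_of_diff (s := - u) x1); field.
Qed.

(** * Solutions on the characters and the arithmetic conditions *)

(* On the character k |-> w^k of Z/2h the circulant with shifts s, -s and h acts
   as multiplication by [circ_eig h s w]. *)
Definition circ_eig (F : fieldType) (h s : nat) (w : F) : F :=
  w ^+ s + w ^- s + w ^+ h.

(** Singularity of the 2 by 2 matrix with diagonal l_a(w), l_b(w) and off-diagonal entries 1, by
    which the graph acts on the two copies of the character w. *)
Definition kernel_eq (h a b : nat) (w : algC) : Prop :=
  circ_eig h a w * circ_eig h b w = 1.

Definition nut_conditions (h a b : nat) : Prop :=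
  [/\ odd h, ~~ odd a /\ ~~ odd b, gcdn (gcdn h a) b = 1%N &
    (5 %| h)%N -> [\/ (5 %| a)%N, (5 %| b)%N, a = b %[mod 5] | (5 %| a + b)%N]].

(** The quotient b/a is a unit modulo 5 other than 1 and -1, hence 2 or -2 = 3. *)
Lemma modn5_cases (a b : nat) :
    ~ [\/ (5 %| a)%N, (5 %| b)%N, a = b %[mod 5] | (5 %| a + b)%N] ->
  b = (2 * a)%N %[mod 5] \/ b = (3 * a)%N %[mod 5].
Proof.
move=> nab; suff: [\/ (5 %| a)%N, (5 %| b)%N, a = b %[mod 5] | (5 %| a + b)%N] \/
    (b = (2 * a)%N %[mod 5] \/ b = (3 * a)%N %[mod 5]) by case.
rewrite /dvdn -(modnDm a) -[(2 * a %% 5)%N]modnMmr -[(3 * a %% 5)%N]modnMmr.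
have := ltn_pmod a (isT : 0 < 5)%N; have := ltn_pmod b (isT : 0 < 5)%N.
move: (a %% 5)%N (b %% 5)%N => i j.
case: j => [|[|[|[|[|j]]]]] //; case: i => [|[|[|[|[|i]]]]] // _ _;
  first [by left; constructor | by right; left | by right; right].
Qed.

Lemma kernel_eqV h a b w : w ^+ (h * 2) = 1 -> kernel_eq h a b w ->
  kernel_eq h a b w^-1.
Proof.
rewrite /kernel_eq /circ_eig exprM => /eqP wh; rewrite !exprVn !invrK.
suff -> : w ^- h = w ^+ h by rewrite [w ^- a + _]addrC [w ^- b + _]addrC.
by move: wh; rewrite sqrf_eq1 => /orP[] /eqP ->; rewrite ?invrN invr1.
Qed.

Lemma kernel_eq1 h a b : ~ kernel_eq h a b 1.
Proof.
rewrite /kernel_eq /circ_eig !expr1n invr1 => E.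
suff /eqP : 8%:R = 0 :> algC by rewrite pnatr_eq0.
by rewrite -[RHS](subrr 1) -[X in _ = X - _]E; ring.
Qed.

(** At -1 each eigenvalue is 1 or -3 for odd h, and -1 or 3 for even h; the product is 1 only when
    both have absolute value 1. *)
Lemma kernel_eqN1 h a b :
  kernel_eq h a b (-1) <-> odd a = ~~ odd h /\ odd b = ~~ odd h.
Proof.
have absurd n : n.+1%:R = 0 :> algC -> False by move/eqP; rewrite pnatr_eq0.
rewrite /kernel_eq /circ_eig -(signr_odd _ a) -(signr_odd _ b) -(signr_odd _ h).
case: (odd a); case: (odd b); case: (odd h);
  rewrite /= ?expr1 ?expr0 ?invrN ?invr1; split=> //.
all: try by case.
all: try by move=> _; ring.
all: move=> E; exfalso.
all: try by apply: (absurd 7); rewrite -[RHS](subrr 1) -[X in _ = X - _]E; ring.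
all: by apply: (absurd 3); rewrite -[RHS](subrr 1) -[X in _ = _ - X]E; ring.
Qed.

Lemma unique_kernel_eq_necessary h a b w0 : (0 < h)%N ->
    w0 ^+ (h * 2) = 1 -> kernel_eq h a b w0 ->
    (forall w, w ^+ (h * 2) = 1 -> kernel_eq h a b w -> w = w0) ->
  nut_conditions h a b.
Proof.
move=> h0 w0m K0 uniq.
have w0nz := unity_neq0 (_ : 0 < h * 2)%N w0m.
have w0E : w0 = -1.
  have : w0 ^+ 2 = 1.
    have : w0^-1 = w0.
      by apply: uniq (kernel_eqV w0m K0); rewrite exprVn w0m invr1.
    by rewrite expr2 => {1}<-; rewrite mulVf // w0nz // muln_gt0 h0.
  move/eqP; rewrite sqrf_eq1 => /orP[] /eqP // w01.
  by move: K0; rewrite w01 => /kernel_eq1.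
subst w0; have [oa ob] := (kernel_eqN1 h a b).1 K0.
have N1neq1 : (1 : algC) <> -1.
  by move/eqP; rewrite -subr_eq0 opprK -mulr2n pnatr_eq0.
have oh : odd h.
  (* For even h, a and b are odd, so i^a + i^-a = i^b + i^-b = 0. Both eigenvalues at i are i^h, and
     their product is (-1)^h = 1: a second solution. *)
  apply/negPn/negP => eh; rewrite eh in oa ob.
  have im : 'i ^+ (h * 2) = 1 :> algC.
    by rewrite mulnC exprM sqrCi -signr_odd (negbTE eh).
  have iodd c : odd c -> 'i ^+ c + 'i ^- c = 0 :> algC.
    move=> oc; rewrite -exprVn invCi exprNn -signr_odd oc expr1.
    by rewrite mulN1r subrr.
  have Ki : kernel_eq h a b 'i.
    by rewrite /kernel_eq /circ_eig !iodd // !add0r -expr2 -exprM.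
  have := sqrCi algC; rewrite (uniq _ im Ki) sqrrN expr1n.
  exact: N1neq1.
rewrite oh /= in oa ob.
(* The candidate solution is -z: as a and b are even and h is odd, (-z)^a = z^a, (-z)^b = z^b and
   (-z)^h = -1. *)
have Nroot (d : nat) (z : algC) : (d %| h)%N -> z ^+ d = 1 ->
    (z ^+ a + z ^- a - 1) * (z ^+ b + z ^- b - 1) = 1 -> z = 1.
  case/dvdnP=> q hE zd E; apply: oppr_inj; apply: uniq.
    by rewrite mulnC exprM sqrrN -exprM mulnC hE mulnAC [(_ * d)%N]mulnC exprM zd expr1n.
  rewrite /kernel_eq /circ_eig ![(- z) ^+ _]exprNn -(signr_odd _ a)
    -(signr_odd _ b) -(signr_odd _ h).
  by rewrite oa ob oh expr0 expr1 !mul1r hE [(q * d)%N]mulnC exprM zd expr1n mulr1.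
split=> //; first by rewrite oa ob.
  set d := gcdn _ _; have d0 : (0 < d)%N by rewrite !gcdn_gt0 h0.
  have [z zd] := C_prim_root_exists d0.
  have dh : (d %| h)%N by rewrite (dvdn_trans (dvdn_gcdl _ _)) ?dvdn_gcdl.
  have da : (d %| a)%N by rewrite (dvdn_trans (dvdn_gcdl _ _)) ?dvdn_gcdr.
  have db : (d %| b)%N by rewrite dvdn_gcdr.
  apply/eqP; rewrite -dvdn1 (prim_order_dvd zd) expr1; apply/eqP.
  apply: (Nroot d) => //; first exact: prim_expr_order.
  have -> : z ^+ a = 1 by apply/eqP; rewrite -(prim_order_dvd zd).
  have -> : z ^+ b = 1 by apply/eqP; rewrite -(prim_order_dvd zd).
  by rewrite invr1; ring.
move=> h5; have [//|nab] := boolP [|| 5 %| a, 5 %| b, a == b %[mod 5] | 5 %| a + b]%N.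
  by case/or4P=> ?;
    [constructor 1 | constructor 2 | constructor 3; apply/eqP | constructor 4].
exfalso; have [z z5] := C_prim_root_exists (isT : 0 < 5)%N.
suff /eqP : z = 1 by rewrite -[z]expr1 -(prim_order_dvd z5).
apply: (Nroot 5) => //; first exact: prim_expr_order.
set x := z ^+ a; have x5 : x ^+ 5 = 1.
  by rewrite exprAC (prim_expr_order z5) expr1n.
have x0 := unity_neq0 (isT : 0 < 5)%N x5.
(* Since b is 2a or -2a modulo 5, z^b is x^2 or x^-2, and this identity makes -z a solution in both
   cases. *)
have poly0 : (x + x^-1 - 1) * (x ^+ 2 + x ^- 2 - 1) = 1.
  apply/eqP; rewrite -subr_eq0; apply/eqP.
  transitivity ((x - 1) * (x ^+ 5 - 1) / x ^+ 3); first by field.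
  by rewrite x5 subrr mulr0 mul0r.
have [|b2|b3] := @modn5_cases a b.
- by case=> H; move: nab; rewrite ?H ?orbT // eqxx !orbT.
- have -> : z ^+ b = x ^+ 2.
    by apply/eqP; rewrite -exprM mulnC (eq_prim_root_expr z5); apply/eqP.
  by [].
have -> : z ^+ b = x ^- 2.
  have -> : z ^+ b = x ^+ 3.
    by apply/eqP; rewrite -exprM mulnC (eq_prim_root_expr z5); apply/eqP.
  have x20 : x ^+ 2 != 0 by rewrite expf_neq0.
  by apply: (mulIf x20); rewrite mulVf // -exprD.
by rewrite invrK [x ^- 2 + _]addrC.
Qed.

Lemma unique_kernel_eq_sufficient h a b w : nut_conditions h a b ->
  w ^+ (h * 2) = 1 -> kernel_eq h a b w -> w = -1.
Proof.
move=> [oh [ea eb] gcd1 h5] wm K; set c := w ^+ h in K *.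
have c2 : c ^+ 2 = 1 by rewrite -exprM.
have [e e1 ce] : exists2 e : int, e = 1 \/ e = -1 & c = e%:~R.
  move/eqP: c2; rewrite sqrf_eq1 => /orP[] /eqP ->.
    by exists 1; [left | rewrite rmorph1].
  by exists (-1); [right | rewrite rmorphN rmorph1].
have ceven k : ~~ odd k -> c ^+ k = 1.
  move=> ek; rewrite -[k]odd_double_half (negbTE ek) -muln2 mulnC exprM c2.
  by rewrite expr1n.
(* Multiplying w by the sign c = w^h makes the order odd, as c^(h+1) = 1, and leaves w^a and w^b
   unchanged because a and b are even. *)
have vh : (c * w) ^+ h = 1.
  by rewrite exprMn -/c -exprSr ceven //= oh.
have h0 : (0 < h)%N by case: (h) oh.
have [N N_prim Nh] := prim_order_exists h0 vh; set v := c * w in N_prim vh.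
have vE k : ~~ odd k -> v ^+ k = w ^+ k by move=> ek; rewrite exprMn ceven ?mul1r.
have vN := prim_expr_order N_prim.
(* N divides ak, bk and hk, hence k times gcd(h, a, b) = 1. *)
have gen k : (v ^+ a) ^+ k = 1 -> (v ^+ b) ^+ k = 1 -> (N %| k)%N.
  rewrite -!exprM => /eqP + /eqP; rewrite -!(prim_order_dvd N_prim) => Nak Nbk.
  by rewrite -[k]mul1n -gcd1 !muln_gcdl !dvdn_gcd Nak Nbk dvdn_mulr.
have Nodd : odd N by apply: dvdn_odd Nh _.
have K' : nut_eq e (v ^+ a) (v ^+ b) by rewrite /nut_eq !vE // -ce.
have xN k : (v ^+ k) ^+ N = 1 by rewrite exprAC vN expr1n.
case: (nut_eq_odd_unity Nodd (xN a) (xN b) gen e1 K').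
  case=> va vb eE; have := gen 1%N; rewrite va vb expr1 => /(_ erefl erefl).
  rewrite (prim_order_dvd N_prim) expr1 /v ce eE rmorphN rmorph1 mulN1r.
  by rewrite eqr_oppLR => /eqP.
(* Here v has order 5, so 5 | h, and the four inequalities say that 5 divides none of a, b, a - b, a
   + b. *)
case=> [[va5 vb5] va vb vab vab1].
have N5 : N = 5%N.
  case/primeP: (isT : prime 5) => _ /(_ N (gen 5%N va5 vb5)) /orP[] /eqP // N1.
  by move: va; rewrite -[v ^+ a]expr1 -{1}N1 xN eqxx.
subst N; case: (h5 Nh); rewrite ?(prim_order_dvd N_prim) //.
- by rewrite (negbTE va).
- by rewrite (negbTE vb).
- by move/eqP; rewrite -(eq_prim_root_expr N_prim) (negbTE vab).
- by rewrite exprD (negbTE vab1).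
Qed.

(** * Characteristic polynomials and the multiplicity of the root 0 *)

Lemma mup_map (F K : fieldType) (f : {rmorphism F -> K}) (p : {poly F}) (x : F) :
  p != 0 -> mup (f x) (map_poly f p) = mup x p.
Proof.
move=> p0; have fp0 : map_poly f p != 0 by rewrite map_poly_eq0.
have geq n : (n <= mup (f x) (map_poly f p))%N = (n <= mup x p)%N.
  rewrite !mup_geq // -(dvdp_map f) rmorphXn rmorphB /= map_polyX.
  by rewrite map_polyC.
by apply/eqP; rewrite eqn_leq -geq leqnn geq leqnn.
Qed.

Lemma char_poly_conj (F : fieldType) (n k : nat) (A : 'M[F]_n) (B : 'M[F]_k)
    (P : 'M_(n, k)) (Q : 'M_(k, n)) :
  n = k -> Q *m P = 1%:M -> A *m P = P *m B -> char_poly A = char_poly B.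
Proof.
move=> nk; subst k => QP AP; have P0 : \det (map_mx (@polyC F) P) != 0.
  rewrite det_map_mx polyC_eq0; apply: contraTneq (oner_neq0 F) => detP.
  by rewrite -(det1 F n) -QP det_mulmx detP mulr0 eqxx.
apply: (mulIf P0); rewrite -det_mulmx mulrC -det_mulmx; congr (\det _).
by rewrite mulmxBl mulmxBr -!map_mxM AP mul_scalar_mx scalar_mxC mul_scalar_mx.
Qed.

Lemma det_block_diag1 (R : idomainType) (n : nat) (u v : 'rV[R]_n) :
  (forall j, v 0 j != 0) ->
  \det (block_mx (diag_mx u) (-1%:M) (-1%:M) (diag_mx v)) =
    \prod_j (u 0 j * v 0 j - 1).
Proof.
move=> v0; have detv : \det (diag_mx v) != 0 by rewrite det_diag; apply/prodf_neq0 => j _.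
apply: (mulIf detv).
(* Right multiplication by this block triangular matrix, of determinant det(diag v), clears the
   lower left block. *)
transitivity (\det (block_mx (diag_mx u) (-1%:M) (-1%:M) (diag_mx v) *m
                    block_mx (diag_mx v) 0 1%:M 1%:M)).
  by rewrite det_mulmx det_lblock det1 mulr1.
rewrite mulmx_block !mulNmx !mul1mx !mulmx0 !mulmx1 addNr oppr0 !add0r.
rewrite det_ublock; congr (_ * _); rewrite mulmx_diag.
have -> : diag_mx (\row_j (u 0 j * v 0 j)) - 1%:M =
    diag_mx (\row_j (u 0 j * v 0 j - 1)) :> 'M_n.
  by apply/matrixP => i j; rewrite !mxE; case: eqP => _; rewrite ?subrr.
by rewrite det_diag; apply: eq_bigr => j _; rewrite mxE.
Qed.

Lemma char_poly_block_diag1 (F : fieldType) (n : nat) (u v : 'rV[F]_n) :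
  char_poly (block_mx (diag_mx u) 1%:M 1%:M (diag_mx v)) =
    \prod_j (('X - (u 0 j)%:P) * ('X - (v 0 j)%:P) - 1).
Proof.
have XD (w : 'rV[F]_n) :
    'X%:M - map_mx polyC (diag_mx w) = diag_mx (\row_j ('X - (w 0 j)%:P)).
  apply/matrixP => i j; rewrite !mxE; case: eqP => _; rewrite ?mulr1n ?mulr0n //.
  by rewrite polyC0 subrr.
rewrite /char_poly /char_poly_mx map_block_mx scalar_mx_block opp_block_mx add_block_mx.
rewrite !XD !map_mx1 !add0r det_block_diag1.
  by apply: eq_bigr => j _; rewrite !mxE.
by move=> j; rewrite mxE polyXsubC_eq0.
Qed.

(** A factor with uv = 1 equals X(X - (u + v)). There 0 is a simple root, because u + v = 0 would
    give u^2 = -1 for a real u; two such factors give multiplicity at least 2. *)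
Lemma mup0_prod_quadratics (n : nat) (u v : 'I_n -> algC) :
    (forall j, u j \is Num.real) ->
  mup 0 (\prod_j (('X - (u j)%:P) * ('X - (v j)%:P) - 1)) = 1%N <->
  exists j0, u j0 * v j0 = 1 /\ forall j, u j * v j = 1 -> j = j0.
Proof.
move=> ur; pose q j : {poly algC} := ('X - (u j)%:P) * ('X - (v j)%:P) - 1.
rewrite -/(\prod_j q j).
have qE j : u j * v j = 1 -> q j = 'X * ('X - (u j + v j)%:P).
  move=> uv; rewrite /q.
  have -> : 1 = (u j)%:P * (v j)%:P :> {poly algC} by rewrite -polyCM uv.
  by rewrite polyCD; ring.
have root_q j : root (q j) 0 = (u j * v j == 1).
  by rewrite rootE !hornerE mulrNN subr_eq0.
have q0 j : q j != 0.
  rewrite -lead_coef_eq0 /q lead_coefDl; last first.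
    by rewrite size_polyN size_poly1 size_Mmonic ?monicXsubC ?polyXsubC_eq0 // !size_XsubC.
  by rewrite lead_coefM !lead_coefXsubC mulr1 oner_neq0.
have p0 : \prod_j q j != 0 by apply/prodf_neq0.
split=> [mup1|[j0 [uv0 uniq]]].
  have : root (\prod_j q j) 0.
    by apply: contraT => /mupNroot; rewrite mup1.
  rewrite rootE horner_prod => /prodf_eq0[j0 _]; rewrite -rootE root_q => /eqP uv0.
  exists j0; split=> // j uv; apply: contra_eq mup1 => jj0.
  suff : (2 <= mup 0 (\prod_j q j))%N by case: mup => [|[]].
  rewrite mup_geq // subr0 (bigD1 j0) //= (bigD1 j) //= qE // qE // mulrA.
  by rewrite dvdp_mulr // expr2 mulrACA dvdp_mulr.
rewrite (bigD1 j0) //= mupMl; last first.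
  rewrite rootE horner_prod; apply/prodf_neq0 => j; rewrite -rootE root_q.
  by apply: contra_neqN => /eqP /uniq.
rewrite qE // mupMl; last first.
  rewrite root_XsubC eq_sym; apply/eqP => uvs.
  move: uv0; rewrite -(addr0_eq uvs) mulrN => /eqP.
  rewrite eqr_oppLR => /eqP usq; have : 0 <= u j0 * u j0.
    by rewrite -expr2 real_exprn_even_ge0.
  by rewrite usq oppr_ge0 real_leNgt ?ltr01.
by have := @mup_XsubCX algC 1 0 0; rewrite subr0 expr1 eqxx.
Qed.

(** * Diagonalisation of the graph by characters *)

Lemma sum_enum_val (G : nmodType) (T : finType) (f : T -> G) :
  \sum_(i < #|T|) f (enum_val i) = \sum_t f t.
Proof. by rewrite [RHS](reindex _ (onW_bij _ (@enum_val_bij T))). Qed.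

Lemma circ_adjE (h s : nat) (i k : 'I_(h * 2)) : (s < h)%N ->
  circ_adj s i k =
    [|| k == i + s %[mod h * 2], k == i + (h * 2 - s) %[mod h * 2]
      | k == i + h %[mod h * 2]]%N.
Proof.
set m := (h * 2)%N in i k *; move=> sh;
have sm : (s <= m)%N by rewrite (leq_trans (ltnW sh)) // leq_pmulr.
rewrite /circ_adj mulnK //.
have -> : (i%:Z - s%:Z = (i + (m - s))%N%:Z - m%:Z)%R.
  by rewrite PoszD -subzn //; ring.
rewrite -!PoszD !modz_nat.
by rewrite -[((_ - m%:Z) %% _)%Z]modzDr subrK modz_nat.
Qed.

Lemma sum_modn_expr (F : fieldType) (m : nat) (w : F) (t : nat) :
    (0 < m)%N -> w ^+ m = 1 ->
  \sum_(k < m) (k == t %[mod m])%:R * w ^+ k = w ^+ t.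
Proof.
move=> m0 wm; rewrite (bigD1 (Ordinal (ltn_pmod t m0))) //=.
rewrite modn_mod eqxx mul1r expr_mod // big1 ?addr0 // => k kt.
rewrite modn_small //.
by move: kt; rewrite -val_eqE /= => /negbTE ->; rewrite mul0r.
Qed.

Lemma sum_circ_adj (F : fieldType) (h s : nat) (w : F) (i : 'I_(h * 2)) :
    (0 < s)%N -> (s < h)%N -> w ^+ (h * 2) = 1 ->
  \sum_k (circ_adj s i k)%:R * w ^+ k = w ^+ i * circ_eig h s w.
Proof.
set m := (h * 2)%N in i *; move=> s0 sh wm;
have mE : m = (h + h)%N by rewrite /m muln2 addnn.
have sm : (s <= m)%N by rewrite mE (leq_trans (ltnW sh)) ?leq_addr.
have m0 : (0 < m)%N by rewrite mE addn_gt0 (leq_trans _ sh).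
have w0 := unity_neq0 m0 wm.
have -> : circ_eig h s w = w ^+ s + w ^+ (m - s) + w ^+ h.
  by rewrite /circ_eig -[w ^- s]mul1r -wm -expfB_cond // (negbTE w0).
rewrite !mulrDr -!exprD -!(sum_modn_expr _ m0 wm) -!big_split /=.
apply: eq_bigr => k _; rewrite circ_adjE // -!mulrDl; congr (_ * _).
(* The shifts s < h < 2h - s are distinct modulo 2h, so the disjunction in [circ_adj] counts as a
   sum of three indicators. *)
have neq t u : (t < u)%N -> (u < m)%N ->
    (k == i + t %[mod m])%N -> (k == i + u %[mod m])%N = false.
  move=> tu um /eqP ->; rewrite eqn_modDl !modn_small ?(ltn_trans tu) //.
  by rewrite ltn_eqF.
have hms : (h < m - s)%N by rewrite mE ltn_subRL addnC ltn_add2l.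
have msm : (m - s < m)%N by rewrite ltn_subrL s0 m0.
have H1 := neq s h sh (ltn_trans hms msm).
have H2 := neq s (m - s)%N (ltn_trans sh hms) msm.
have H3 := neq h (m - s)%N hms msm.
move: H1 H2 H3; case: eqP => _ H1 H2 H3; first by rewrite H1 // H2 //= !addr0.
move: H3; case: (k == i + h %[mod m])%N => [->|] //=; first by rewrite !add0r.
by rewrite orbF add0r addr0.
Qed.

(** The adjacency matrix over any field, so that it can be moved between R, the rationals and
    [algC]. *)
Definition B1mx (h a b : nat) (F : fieldType) :
    'M[F]_#|{: 'I_(h * 2) + 'I_(h * 2)}| :=
  \matrix_(i, j) (B1 a b (enum_val i) (enum_val j))%:R.

Lemma sum_B1 (F : fieldType) (h a b : nat) (w c d : F)
    (i : 'I_#|{: 'I_(h * 2) + 'I_(h * 2)}|)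
    (g := fun u : 'I_(h * 2) + 'I_(h * 2) =>
      match u with inl k => c * w ^+ k | inr k => d * w ^+ k end) :
    (0 < a)%N -> (a < h)%N -> (0 < b)%N -> (b < h)%N -> w ^+ (h * 2) = 1 ->
  \sum_j B1mx h a b F i j * g (enum_val j) =
    match enum_val i with
    | inl k => w ^+ k * (circ_eig h a w * c + d)
    | inr k => w ^+ k * (c + circ_eig h b w * d)
    end.
Proof.
move=> a0 ah b0 bh wm; under eq_bigr do rewrite mxE.
rewrite (sum_enum_val (fun t => (B1 a b (enum_val i) t)%:R * g t)) /=.
rewrite big_sumType /=; case: (enum_val i) => k /=.
  rewrite (eq_bigr (fun l => c * ((circ_adj a k l)%:R * w ^+ l)));
    last by move=> l _; rewrite mulrCA.
  rewrite -mulr_sumr sum_circ_adj // (bigD1 k) //= eqxx mul1r big1; last first.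
    by move=> l lk; rewrite eq_sym (negbTE lk) mul0r.
  by rewrite addr0; ring.
rewrite [X in _ + X](eq_bigr (fun l => d * ((circ_adj b k l)%:R * w ^+ l)));
  last by move=> l _; rewrite mulrCA.
rewrite -mulr_sumr sum_circ_adj // (bigD1 k) //= eqxx mul1r big1; last first.
  by move=> l lk; rewrite eq_sym (negbTE lk) mul0r.
by rewrite addr0; ring.
Qed.

Lemma char_poly_B1mx (h a b : nat) (z : algC) :
    (0 < a)%N -> (a < h)%N -> (0 < b)%N -> (b < h)%N ->
    (h * 2).-primitive_root z ->
  char_poly (B1mx h a b algC) =
    \prod_(l < h * 2) (('X - (circ_eig h a (z ^+ l))%:P) *
                       ('X - (circ_eig h b (z ^+ l))%:P) - 1).
Proof.
move=> a0 ah b0 bh; set m := (h * 2)%N; pose V := ('I_m + 'I_m)%type => zm.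
pose wl (l : 'I_m) := z ^+ l.
have wlm l : wl l ^+ m = 1 by rewrite exprAC (prim_expr_order zm) expr1n.
have wl0 l : wl l != 0 by rewrite expf_neq0 // (prim_root_eq0 zm) -lt0n (prim_order_gt0 zm).
have m0 : m%:R != 0 :> algC by rewrite pnatr_eq0 -lt0n (prim_order_gt0 zm).
(* The columns of [PL] and [PR] are the characters supported on the x_i and on the y_i; [QL] and
   [QR] are the inverse Fourier transforms on the two halves. *)
pose inL (f : nat -> algC) (t : V) : algC := if t is inl k then f k else 0.
pose inR (f : nat -> algC) (t : V) : algC := if t is inr k then f k else 0.
pose wp l k := wl l ^+ k; pose wn l k := wl l ^- k / m%:R.
pose PL : 'M[algC]_(#|{: V}|, m) := \matrix_(i, l) inL (wp l) (enum_val i).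
pose PR : 'M[algC]_(#|{: V}|, m) := \matrix_(i, l) inR (wp l) (enum_val i).
pose QL : 'M[algC]_(m, #|{: V}|) := \matrix_(l, i) inL (wn l) (enum_val i).
pose QR : 'M[algC]_(m, #|{: V}|) := \matrix_(l, i) inR (wn l) (enum_val i).
pose u := \row_l circ_eig h a (wl l); pose v := \row_l circ_eig h b (wl l).
have orth l l' : \sum_(k < m) wn l k * wp l' k = (l == l')%:R.
  transitivity (m%:R^-1 * \sum_(k < m) (wl l' / wl l) ^+ k).
    rewrite mulr_sumr; apply: eq_bigr => k _.
    by rewrite exprMn exprVn mulrAC mulrC [_ * wl l' ^+ k]mulrC.
  rewrite sum_expr_unity; last by rewrite exprMn exprVn !wlm invr1 mulr1.
  have -> : (wl l' / wl l == 1) = (l == l').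
    rewrite -(inj_eq (mulIf (wl0 l))) mulfVK // mul1r (eq_prim_root_expr zm).
    by rewrite !modn_small // eq_sym.
  by case: eqP => _; rewrite ?mulr0 // mulVf.
have BL : B1mx h a b algC *m PL = PL *m diag_mx u + PR.
  apply/matrixP => i l; rewrite mul_mx_diag !mxE.
  have := sum_B1 1 0 i a0 ah b0 bh (wlm l); rewrite !addr0 !mulr0 !mulr1 !addr0 => E.
  transitivity (\sum_j B1mx h a b algC i j *
      match enum_val j with inl k => 1 * wl l ^+ k | inr k => 0 * wl l ^+ k end).
    apply: eq_bigr => j _; rewrite !mxE; congr (_ * _).
    by rewrite /inL /inR /wp; case: (enum_val j) => k; rewrite ?mul1r ?mul0r.
  by rewrite E /inL /inR /wp; case: (enum_val i) => k;
    rewrite !(mulr1, mul0r, addr0, add0r).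
have BR : B1mx h a b algC *m PR = PL + PR *m diag_mx v.
  apply/matrixP => i l; rewrite mul_mx_diag !mxE.
  have := sum_B1 0 1 i a0 ah b0 bh (wlm l); rewrite !mulr0 !mulr1 !add0r => E.
  transitivity (\sum_j B1mx h a b algC i j *
      match enum_val j with inl k => 0 * wl l ^+ k | inr k => 1 * wl l ^+ k end).
    apply: eq_bigr => j _; rewrite !mxE; congr (_ * _).
    by rewrite /inL /inR /wp; case: (enum_val j) => k; rewrite ?mul1r ?mul0r.
  by rewrite E /inL /inR /wp; case: (enum_val i) => k;
    rewrite !(mulr1, mul0r, addr0, add0r).
have QP : col_mx QL QR *m row_mx PL PR = 1%:M.
  rewrite mul_col_row scalar_mx_block; congr block_mx; apply/matrixP => l l';
    rewrite !mxE; under eq_bigr do rewrite !mxE.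
  - rewrite (sum_enum_val (fun t => inL (wn l) t * inL (wp l') t)) big_sumType /=.
    by rewrite orth [X in _ + X]big1 ?addr0 // => k _; rewrite mulr0.
  - rewrite (sum_enum_val (fun t => inL (wn l) t * inR (wp l') t)) big_sumType /=.
    by rewrite !big1 ?addr0 // => k _; rewrite ?mulr0 ?mul0r.
  - rewrite (sum_enum_val (fun t => inR (wn l) t * inL (wp l') t)) big_sumType /=.
    by rewrite !big1 ?addr0 // => k _; rewrite ?mulr0 ?mul0r.
  - rewrite (sum_enum_val (fun t => inR (wn l) t * inR (wp l') t)) big_sumType /=.
    by rewrite orth big1 ?add0r // => k _; rewrite mulr0.
rewrite (char_poly_conj (B := block_mx (diag_mx u) 1%:M 1%:M (diag_mx v)) _ QP).
- by rewrite char_poly_block_diag1; apply: eq_bigr => l _; rewrite !mxE.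
- by rewrite card_sum card_ord.
by rewrite mul_mx_row mul_row_block !mulmx1 BL BR.
Qed.

(** Conjugation inverts w, which swaps w^s with w^-s and fixes w^h, a square root of 1. *)
Lemma real_circ_eig (h s : nat) (w : algC) : (0 < h)%N -> w ^+ (h * 2) = 1 ->
  circ_eig h s w \is Num.real.
Proof.
move=> h0 wm; have m0 : (0 < h * 2)%N by rewrite muln_gt0 h0.
have w1 : `|w| = 1.
  by apply/eqP; rewrite -(pexpr_eq1 m0) // -normrX wm normr1.
have wC : w^* = w^-1 by rewrite invC_norm w1 expr1n invr1 mul1r.
rewrite CrealE /circ_eig !rmorphD rmorphV ?unitfE ?expf_neq0 ?(unity_neq0 m0 wm) //.
rewrite !rmorphXn /= wC !exprVn invrK [w ^- s + _]addrC; apply/eqP; congr (_ + _).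
apply: invr_inj; rewrite invrK; apply: (mulIf (_ : w ^+ h != 0)).
  by rewrite expf_neq0 // (unity_neq0 m0 wm).
by rewrite mulVf ?expf_neq0 ?(unity_neq0 m0 wm) // -expr2 -exprM.
Qed.

(** * Simplicity of the eigenvalue 0 and a nowhere zero kernel vector *)

Lemma mup0_char_poly_B1 (R : realType) (h a b : nat) :
    (0 < a)%N -> (a < h)%N -> (0 < b)%N -> (b < h)%N ->
  mup 0 (char_poly (adjmx R (@B1 (h * 2) a b))) = 1%N <->
  exists w0, [/\ w0 ^+ (h * 2) = 1, kernel_eq h a b w0 &
    forall w, w ^+ (h * 2) = 1 -> kernel_eq h a b w -> w = w0].
Proof.
move=> a0 ah b0 bh; have h0 : (0 < h)%N by rewrite (leq_trans _ ah).
have m0 : (0 < h * 2)%N by rewrite muln_gt0 h0.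
have [z zm] := C_prim_root_exists m0.
(* The entries are 0 or 1, so the characteristic polynomial is rational and 0 has the same
   multiplicity over R and over [algC]. *)
have mapB (F : numFieldType) :
    mup 0 (char_poly (B1mx h a b F)) = mup 0 (char_poly (B1mx h a b rat)).
  have -> : B1mx h a b F = map_mx ratr (B1mx h a b rat).
    by apply/matrixP => i j; rewrite !mxE rmorph_nat.
  rewrite -map_char_poly -[X in mup X _](rmorph0 (ratr : {rmorphism rat -> F})).
  by apply: mup_map; rewrite monic_neq0 ?char_poly_monic.
rewrite -[adjmx _ _]/(B1mx h a b R) mapB -(mapB algC) (char_poly_B1mx a0 ah b0 bh zm).
have zlm l : (z ^+ l) ^+ (h * 2) = 1 by rewrite exprAC (prim_expr_order zm) expr1n.
rewrite mup0_prod_quadratics; last by move=> l; apply: real_circ_eig.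
split=> [[l [K0 uniq]]|[w0 [w0m K0 uniq]]].
  exists (z ^+ l); split=> // w /(prim_rootP zm)[l' ->] K.
  by rewrite (uniq l').
have [l0 w0E] := prim_rootP zm w0m; exists l0; rewrite -w0E; split=> // l K.
have := uniq _ (zlm l) K; rewrite w0E => /eqP; rewrite (eq_prim_root_expr zm).
by rewrite !modn_small // => /eqP /val_inj.
Qed.

(** At w = -1 both eigenvalues are 1, so (1, -1) is in the kernel of the 2 by 2 block; the vector is
    (-1)^k on x_k and -(-1)^k on y_k. *)
Lemma B1_kernel_vector (R : realType) (h a b : nat) :
    (0 < a)%N -> (a < h)%N -> (0 < b)%N -> (b < h)%N ->
    odd h -> ~~ odd a -> ~~ odd b ->
  exists v : 'cV[R]_#|{: 'I_(h * 2) + 'I_(h * 2)}|,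
    is_eigenvector (adjmx R (@B1 (h * 2) a b)) 0 v /\ (forall i, v i 0 != 0).
Proof.
move=> a0 ah b0 bh oh ea eb; have h0 : (0 < h)%N by rewrite (leq_trans _ ah).
have m0 : (0 < h * 2)%N by rewrite muln_gt0 h0.
have wm : (-1) ^+ (h * 2) = 1 :> R by rewrite mulnC exprM sqrrN !expr1n.
have lam s : ~~ odd s -> circ_eig h s (-1 : R) = 1.
  move=> es; rewrite /circ_eig -(signr_odd _ s) -(signr_odd _ h) oh (negbTE es).
  by rewrite expr0 expr1 invr1 addrK.
pose g (t : 'I_(h * 2) + 'I_(h * 2)) : R :=
  match t with inl k => 1 * (-1) ^+ k | inr k => -1 * (-1) ^+ k end.
pose v : 'cV[R]_#|{: 'I_(h * 2) + 'I_(h * 2)}| := \col_i g (enum_val i).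
have v0 i : v i 0 != 0.
  rewrite mxE /g; case: (enum_val i) => k; rewrite ?mulN1r ?mul1r ?oppr_eq0 signr_eq0 //.
exists v; split=> //; split.
  apply/eqP => /colP/(_ (enum_rank (inl (Ordinal m0)))); rewrite [RHS]mxE.
  by apply/eqP/v0.
apply/colP => i; rewrite scale0r !mxE -[adjmx _ _]/(B1mx h a b R).
under eq_bigr do rewrite [v _ _]mxE.
rewrite (sum_B1 1 (-1) i a0 ah b0 bh wm) !lam // !mul1r subrr.
by case: (enum_val i) => k; rewrite mulr0.
Qed.

Theorem theorem3p1 (R : realType) (m : nat) (a b : int)
    (hm4 : (4 <= m)%N) (hm : ~~ odd m)
    (ha : 1 <= a) (hab : a <= b) (hb : b < (m %/ 2)%:Z) :
  nut_graph R (@B1 m a b) <->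
  [/\ m = 2 %[mod 4],
      (2 %| a)%Z /\ (2 %| b)%Z,
      gcdz (gcdz (m %/ 2)%:Z a) b = 1
    & (5 %| m)%N ->
      [\/ (5 %| a)%Z, (5 %| b)%Z, (5 %| a - b)%Z | (5 %| a + b)%Z]].
Proof.
have [h mE] : exists h, m = (h * 2)%N.
  by exists m./2; rewrite muln2 even_halfK.
subst m; rewrite mulnK // in hb *.
case: a ha hab => // a; rewrite lez_nat => a0.
case: b hb => // b; rewrite lez_nat ltz_nat => bh ab.
have b0 := leq_trans a0 ab; have ah := leq_ltn_trans ab bh.
have h0 := leq_trans a0 (ltnW ah).
set C := [/\ _, _, _ & _]; have CE : C <-> nut_conditions h a b.
  have d5 : (5 %| h * 2)%N = (5 %| h)%N by rewrite Gauss_dvdl.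
  have sub5 : (5 %| a%:Z - b%:Z)%Z = (a == b %[mod 5])%N.
    by rewrite -eqz_mod_dvd !modz_nat.
  have oh : (h * 2 = 2 %[mod 4])%N <-> odd h.
    rewrite (_ : 4 = 2 * 2)%N // (_ : 2 %% (2 * 2) = 1 * 2)%N // -muln_modl modn2.
    by case: odd; split.
  have ev s : (2 %| s%:Z)%Z = ~~ odd s by rewrite dvdzE /= dvdn2.
  rewrite /C /nut_conditions !ev d5 sub5 !dvdzE /=; split.
    case=> /oh ? ? [gE] H5; split=> // /H5.
    by case=> H;
      [constructor 1 | constructor 2 | constructor 3; apply/eqP | constructor 4].
  case=> /oh ? ? gE H5; split=> //; first by rewrite /gcdz /= gE.
  by move=> /H5; case=> H;
    [constructor 1 | constructor 2 | constructor 3; apply/eqP | constructor 4].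
rewrite {}CE; split=> [[+ _]|cond].
  case/(mup0_char_poly_B1 R a0 ah b0 bh) => w0 [w0m K0 uniq].
  exact: unique_kernel_eq_necessary uniq.
have [oh [ea eb] _ _] := cond; split; last exact: B1_kernel_vector.
apply/(mup0_char_poly_B1 R a0 ah b0 bh); exists (-1); split.
- by rewrite mulnC exprM sqrrN !expr1n.
- by apply/kernel_eqN1; rewrite oh (negbTE ea) (negbTE eb).
by move=> w; apply: unique_kernel_eq_sufficient.
Qed.
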